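(* Let $P$ be a finite poset of width $2$ that cannot be formed from $\mathbf{1}$ and $\mathcal{E}$ using the operation of direct sum; that is, $P$ is not isomorphic to any poset $Q_1\oplus Q_2\oplus\cdots\oplus Q_k$ with $k\ge 1$ and each $Q_i\in\{\mathbf{1},\mathcal{E}\}$. Then $$\delta(P)\ \ge\ \lambda=\frac{-3+5\sqrt{17}}{52}.$$
   Context: The width of a finite poset is the maximum size of an antichain. A linear extension of a finite poset $(P,\le)$ is a total order on $P$ extending $\le$. For $x,y\in P$, $\mathbb{P}(x\prec y)$ denotes the probability that $x$ strictly precedes $y$ in a uniformly random linear extension of $P$, with the convention $\mathbb{P}(x\prec x)=0$. The balance constant of $P$ is $$\delta(P)=\max_{(x,y)\in P^2}\min\{\mathbb{P}(x\prec y),\mathbb{P}(y\prec x)\}.$$ The direct sum $P\oplus Q$ of two posets is the poset on the disjoint union of their underlying sets in which $x\le y$ precisely when $x\le_P y$, or $x\le_Q y$, or both $x\in P$ and $y\in Q$. $\mathbf{1}$ is the one-element poset. $\mathcal{E}$ is the three-element poset with exactly one (nontrivial) relation $x\le y$, i.e. the disjoint union of a two-element chain and a single element incomparable to both. *)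

(* Defs.v *)
From HB Require Import structures.
From mathcomp Require Import all_boot all_order all_algebra.

Set Implicit Arguments.
Unset Strict Implicit.
Unset Printing Implicit Defensive.

Import Order.TTheory GRing.Theory Num.Theory.

Section Width.
Context {d : Order.disp_t} (P : finPOrderType d).

Definition antichain (A : {set P}) : bool :=
  [forall x in A, forall y in A, (x != y) ==> (x >< y)%O].

Definition width : nat := \max_(A : {set P} | antichain A) #|A|.

End Width.

Section LinearExtensions.
Context {d : Order.disp_t} (P : finPOrderType d).

(* A binary relation on P is encoded as its graph, so that the linear         *)
(* extensions of P form a finite set.                                         *)
Definition linear_extension (L : {set P * P}) : bool :=
  [&& [forall x, forall y, ((x <= y)%O) ==> ((x, y) \in L)],
      [forall x, forall y, ((x, y) \in L) && ((y, x) \in L) ==> (x == y)],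
      [forall x, forall y, forall z,
         ((x, y) \in L) && ((y, z) \in L) ==> ((x, z) \in L)]
    & [forall x, forall y, ((x, y) \in L) || ((y, x) \in L)]].

Definition linear_extensions : {set {set P * P}} :=
  [set L | linear_extension L].

Local Open Scope ring_scope.

(* Strict precedence: [prec_prob R x x = 0].                                  *)
Definition prec_prob (R : rcfType) (x y : P) : R :=
  #|[set L in linear_extensions | (x != y) && ((x, y) \in L)]|%:R
    / #|linear_extensions|%:R.

(* The default value 0 is harmless: all the terms are nonnegative, and the    *)
(* diagonal terms are 0.                                                      *)
Definition balance_constant (R : rcfType) : R :=
  \big[Num.max/0]_(p : P * P)
    Num.min (prec_prob R p.1 p.2) (prec_prob R p.2 p.1).

End LinearExtensions.

Definition order_isomorphic {d1 d2 : Order.disp_t}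
    (P : finPOrderType d1) (Q : finPOrderType d2) : Prop :=
  exists2 f : P -> Q, bijective f & {mono f : x y / (x <= y)%O}.

(* A copy of the type [P + Q], to carry the order of the direct sum.          *)
Definition dsum (P Q : Type) : Type := (P + Q)%type.

HB.instance Definition _ (P Q : finType) := Finite.copy (dsum P Q) (P + Q)%type.

Section DirectSum.
Context {d : Order.disp_t} (P Q : finPOrderType d).

Definition dsum_le (u v : dsum P Q) : bool :=
  match u, v with
  | inl x, inl y => (x <= y)%O
  | inr x, inr y => (x <= y)%O
  | inl _, inr _ => true
  | inr _, inl _ => false
  end.

Lemma dsum_le_refl : reflexive dsum_le.
Proof. by case=> x /=. Qed.

Lemma dsum_le_anti : antisymmetric dsum_le.
Proof. by move=> [x|x] [y|y] //= /le_anti ->. Qed.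

Lemma dsum_le_trans : transitive dsum_le.
Proof. by move=> [y|y] [x|x] [z|z] //=; apply: le_trans. Qed.

HB.instance Definition _ := Order.Le_isPOrder.Build d (dsum P Q)
  dsum_le_refl dsum_le_anti dsum_le_trans.

End DirectSum.

Notation ord_display := Order.OrdinalOrder.ord_display.

(* The poset on {0, 1, 2} whose only nontrivial relation is 0 <= 1.           *)
Definition poset_E : Type := 'I_3.

HB.instance Definition _ := Finite.copy poset_E 'I_3.

Definition poset_E_le (x y : poset_E) : bool :=
  (x == y) || ((val x == 0) && (val y == 1)).

Lemma poset_E_le_refl : reflexive poset_E_le.
Proof. by move=> x; rewrite /poset_E_le eqxx. Qed.

Lemma poset_E_le_anti : antisymmetric poset_E_le.
Proof.
move=> x y; rewrite /poset_E_le => /andP[/orP[/eqP //|/andP[/eqP x0 _]]].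
by rewrite x0 andbF orbF => /eqP.
Qed.

Lemma poset_E_le_trans : transitive poset_E_le.
Proof.
move=> y x z; rewrite /poset_E_le => /orP[/eqP -> //|/andP[x0 /eqP y1]].
by rewrite y1 andFb orbF => /eqP <-; rewrite x0 y1 orbT.
Qed.

HB.instance Definition _ := Order.Le_isPOrder.Build ord_display poset_E
  poset_E_le_refl poset_E_le_anti poset_E_le_trans.

Inductive block := block_1 | block_E.

Definition block_poset (b : block) : finPOrderType ord_display :=
  match b with
  | block_1 => 'I_1
  | block_E => poset_E
  end.

(* [block_sum b [:: b2; ...; bk]] is the direct sum of b, b2, ..., bk, hence  *)
(* a sum of at least one block.                                               *)
Fixpoint block_sum (b : block) (s : seq block) : finPOrderType ord_display :=
  match s with
  | [::] => block_poset b
  | b' :: s' => dsum (block_poset b) (block_sum b' s')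
  end.

Definition sum_of_1_and_E {d : Order.disp_t} (P : finPOrderType d) : Prop :=
  exists (b : block) (s : seq block), order_isomorphic P (block_sum b s).

(* Main.v *)
Require Import Defs.
From mathcomp Require Import all_boot all_order all_algebra zify ring lra.

(* A poset of width 2 is covered by two chains a_1 < a_2 < ... and            *)
(* b_1 < b_2 < ..., and its linear extensions are the lattice paths through   *)
(* its lower sets (i, j) = {a_1, ..., a_i, b_1, ..., b_j}. Let n(i, j) be the *)
(* number of paths from (i, j) to the end, divided by the total number of     *)
(* paths; n is log-concave in each direction. A bottom summand 1 or E can be  *)
(* removed without changing any probability, so let a_1 and b_1 be minimal    *)
(* and suppose that no probability lies in [lambda, 1 - lambda], and, say,    *)
(* that P(b_1 < a_1) < lambda.                                                *)
(* The probabilities P(b < a_k) increase with k and have to jump over that    *)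
(* interval, of length 1 - 2 lambda. For b = b_1 the increments n(k - 1, 1)   *)
(* decrease, which forces the jump to be between k = 1 and k = 2, and         *)
(* n(0, 1), n(1, 1), n(2, 0) all to be close to 1/3. If a_2 < b_2, then       *)
(* either E is a bottom summand, or the increments of P(a_3 < b_k) are too    *)
(* small for a jump. Otherwise P(b_2 < a_k) jumps at its second or third      *)
(* increment, 2 n(1, 2) or 3 n(2, 2), and both contradict log-concavity:      *)
(* n(1, 0) n(1, 2) <= n(1, 1)^2 and n(2, 0) n(2, 2) <= n(2, 1)^2. The latter  *)
(* inequality is sharp exactly when 26 lambda^2 + 3 lambda = 4.               *)

Set Implicit Arguments.
Unset Strict Implicit.
Unset Printing Implicit Defensive.

Import Order.TTheory GRing.Theory Num.Theory.

(** The proof is by contraposition. If the balance constant is below [lam], then of any two elements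
    one precedes the other with probability less than [lam] ([gapped]), and a nonempty gapped set
    without three pairwise incomparable elements is a direct sum of blocks ([gapped_blocky]). It
    suffices to split off one bottom block ([gapped_bottom]): counts factor over a direct sum
    ([num_sum], [num_lt_sum]), so what remains is gapped again.

    Two facts about lattice paths carry the argument. The number of elements of [A] before a given
    element of [B] is read off where the path leaves a row ([num_lt_sum_paths]), so its distribution
    function grows by explicit steps, and the gap makes one of these exceed [1 - 2 * lam]
    ([crossing]). Against such large steps stand monotonicity and log-concavity of path counts
    ([paths_log_concave]). Together they decide which small lower sets exist ([v20], [no_overlap],
    [third_above]), and [bottom_E] recognises the summand E from that. The value of [lam] is
    dictated by [jump2_absurd]. *)

Section RelativeExtensions.
Context {d : Order.disp_t} {P : finPOrderType d}.
Implicit Types (S D : {set P}) (L : {set P * P}).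

(** * Counting the linear extensions of a subset by their first element *)

Definition lin_on S L : bool :=
  [&& L \subset setX S S,
      [forall x in S, forall y in S, (x <= y)%O ==> ((x, y) \in L)],
      [forall x, forall y, ((x, y) \in L) && ((y, x) \in L) ==> (x == y)],
      [forall x, forall y, forall z,
         ((x, y) \in L) && ((y, z) \in L) ==> ((x, z) \in L)]
    & [forall x in S, forall y in S, ((x, y) \in L) || ((y, x) \in L)]].

Lemma lin_onP S L :
  reflect [/\ forall x y, (x, y) \in L -> x \in S /\ y \in S,
              {in S &, forall x y, (x <= y)%O -> (x, y) \in L},
              forall x y, (x, y) \in L -> (y, x) \in L -> x = y,
              forall x y z, (x, y) \in L -> (y, z) \in L -> (x, z) \in L
            & {in S &, forall x y, (x, y) \in L \/ (y, x) \in L}]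
          (lin_on S L).
Proof.
apply: (iffP and5P) => -[LS le_L asym tr tot]; split.
- by move=> x y /(subsetP LS); rewrite in_setX => /andP.
- move=> x y xS yS.
  by move/forall_inP/(_ x xS)/forall_inP/(_ y yS)/implyP: le_L.
- move=> x y xy yx; apply/eqP.
  by move/forallP/(_ x)/forallP/(_ y)/implyP: asym => ->; rewrite // xy yx.
- move=> x y z xy yz.
  move/forallP/(_ x)/forallP/(_ y)/forallP/(_ z)/implyP: tr => -> //.
  by rewrite xy yz.
- by move=> x y xS yS; move/forall_inP/(_ x xS)/forall_inP/(_ y yS)/orP: tot.
- by apply/subsetP => -[x y] /LS []; rewrite in_setX => -> ->.
- by apply/forall_inP=> x xS; apply/forall_inP=> y yS; apply/implyP/le_L.
- apply/forallP=> x; apply/forallP=> y; apply/implyP=> /andP[xy yx].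
  by apply/eqP/asym.
- apply/forallP=> x; apply/forallP=> y; apply/forallP=> z.
  by apply/implyP=> /andP[xy yz]; apply: tr yz.
- by apply/forall_inP=> x xS; apply/forall_inP=> y yS; apply/orP/tot.
Qed.

Definition exts S : {set {set P * P}} := [set L | lin_on S L].
Definition num S : nat := #|exts S|.
Definition num_lt S (x y : P) : nat := #|[set L in exts S | (x, y) \in L]|.

Lemma exts_setT : exts setT = linear_extensions P.
Proof.
apply/setP=> L; rewrite !inE; apply/lin_onP/and4P => -[].
  move=> _ le_L asym tr tot; split.
  - by apply/forallP=> x; apply/forallP=> y; apply/implyP/le_L; rewrite inE.
  - apply/forallP=> x; apply/forallP=> y; apply/implyP=> /andP[xy yx].
    by apply/eqP/asym.
  - apply/forallP=> x; apply/forallP=> y; apply/forallP=> z.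
    by apply/implyP=> /andP[xy yz]; apply: tr yz.
  - by apply/forallP=> x; apply/forallP=> y; apply/orP/tot; rewrite inE.
move=> le_L asym tr tot; split.
- by move=> x y; rewrite !inE.
- by move=> x y _ _; move/forallP/(_ x)/forallP/(_ y)/implyP: le_L.
- move=> x y xy yx; apply/eqP.
  by move/forallP/(_ x)/forallP/(_ y)/implyP: asym => ->; rewrite // xy yx.
- move=> x y z xy yz.
  move/forallP/(_ x)/forallP/(_ y)/forallP/(_ z)/implyP: tr => -> //.
  by rewrite xy yz.
- by move=> x y _ _; move/forallP/(_ x)/forallP/(_ y)/orP: tot.
Qed.

Definition mins S : {set P} := [set x in S | [forall y in S, ~~ (y < x)%O]].

Lemma minsP S x :
  reflect (x \in S /\ {in S, forall y, ~~ (y < x)%O}) (x \in mins S).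
Proof.
by rewrite inE; apply: (iffP andP) => -[xS /forall_inP].
Qed.

Lemma mins_neq0 S : S != set0 -> mins S != set0.
Proof.
case/set0Pn=> x0 x0S.
case: (arg_minnP (fun x => #|[set y | (y < x)%O]|) x0S) => x xS xmin.
apply/set0Pn; exists x; apply/minsP; split=> // y yS; apply/negP=> yx.
have := xmin y yS; apply/negP; rewrite -ltnNge proper_card //.
apply/properP; split; first by apply/subsetP=> z; rewrite !inE => /lt_trans ->.
by exists y; rewrite !inE ?ltxx.
Qed.

Definition first_in S x L : bool := [forall y in S, (x, y) \in L].

Lemma first_exists S L : lin_on S L -> S != set0 ->
  exists2 x, x \in mins S & first_in S x L.
Proof.
case/lin_onP=> LS le_L asym tr tot /set0Pn[x0 x0S].
case: (arg_maxnP (fun x => #|[set y | (x, y) \in L]|) x0S) => x xS xmax.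
have xfirst y : y \in S -> (x, y) \in L.
  move=> yS; case: (tot x y xS yS) => // yx.
  have sub : [set z | (x, z) \in L] \subset [set z | (y, z) \in L].
    by apply/subsetP=> z; rewrite !inE; apply: tr.
  have /setP/(_ y) : [set z | (x, z) \in L] = [set z | (y, z) \in L].
    by apply/eqP; rewrite eqEcard sub; apply: xmax.
  by rewrite !inE => ->; apply: le_L.
exists x; last by apply/forall_inP.
apply/minsP; split=> // y yS; apply/negP=> yx.
have := asym _ _ (xfirst y yS) (le_L y x yS xS (ltW yx)).
by move=> xy; rewrite xy ltxx in yx.
Qed.

Lemma first_uniq S L x y : lin_on S L -> x \in S -> y \in S ->
  first_in S x L -> first_in S y L -> x = y.
Proof.
case/lin_onP=> _ _ asym _ _ xS yS /forall_inP xf /forall_inP yf.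
by apply: asym; [apply: xf | apply: yf].
Qed.

(** Each extension of a nonempty set has exactly one first element, and it is minimal; so the
    indicators of being first sum to 1. *)
Lemma card_exts_first S (Q : pred {set P * P}) : S != set0 ->
  #|[set L in exts S | Q L]| =
  \sum_(x in mins S) #|[set L in exts S | first_in S x L && Q L]|.
Proof.
move=> S0; rewrite -sum1_card.
transitivity (\sum_(L in [set L in exts S | Q L])
    \sum_(x in mins S) (first_in S x L : nat)).
  apply: eq_bigr => L; rewrite !inE => /andP[linL _].
  have [x xm xf] := first_exists linL S0.
  rewrite (bigD1 x) //= xf big1 // => y /andP[ym yx].
  case: (boolP (first_in S y L)) => // yf; case/eqP: yx.
  have [[xS _] [yS _]] := (minsP _ _ xm, minsP _ _ ym).
  exact: first_uniq linL yS xS yf xf.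
rewrite exchange_big /=; apply: eq_bigr => x _.
rewrite -sum1_card big_mkcond [RHS]big_mkcond /=; apply: eq_bigr => L _.
by rewrite !inE; case: lin_on; case: Q; case: first_in.
Qed.

Definition cons_ext S x L : {set P * P} := L :|: setX [set x] S.

Lemma cons_ext_lin S x L : x \in mins S -> lin_on (S :\ x) L ->
  lin_on S (cons_ext S x L).
Proof.
move=> /minsP[xS xmin] /lin_onP[LS le_L asym tr tot].
have LSx y : (y, x) \in L -> False by case/LS=> _; rewrite !inE eqxx.
have LxS y : (x, y) \in L -> False by case/LS; rewrite !inE eqxx.
apply/lin_onP; split.
- move=> y z; rewrite !inE /= => /orP[/LS|]; last by case/andP=> /eqP ->.
  by rewrite !inE => -[/andP[_ ->] /andP[_ ->]].
- move=> y z yS zS yz; rewrite !inE /= zS andbT.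
  have [//|yx] := eqVneq y x; first by rewrite orbT.
  have zx : z != x.
    by apply: contraNneq (xmin y yS) => zx; rewrite lt_neqAle yx -zx.
  by rewrite orbF; apply: le_L; rewrite // !inE ?yx ?zx.
- move=> y z; rewrite !inE /=.
  case/orP=> [yz|/andP[/eqP-> _]]; case/orP=> [zy|/andP[/eqP ez _]].
  + exact: asym.
  + by subst z; case: (LSx y).
  + by case: (LSx z).
  + by [].
- move=> y z t; rewrite !inE /=.
  case/orP=> [yz|/andP[/eqP-> zS]]; case/orP=> [zt|/andP[/eqP ez tS]].
  + by rewrite (tr _ _ _ yz zt).
  + by subst z; case: (LSx y).
  + by case/LS: zt => _; rewrite !inE eqxx => /andP[_ ->]; rewrite orbT.
  + by rewrite eqxx tS orbT.
- move=> y z yS zS; rewrite !inE /= yS zS !andbT.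
  have [->|yx] := eqVneq y x; first by left; rewrite orbT.
  have [->|zx] := eqVneq z x; first by right; rewrite orbT.
  by rewrite !orbF; apply: tot; rewrite !inE ?yx ?zx.
Qed.

(** Putting [x] back below everything is a bijection from the extensions of [S :\ x]; its inverse
    restricts [L] to [S :\ x]. *)
Lemma card_exts_cons S x (Q : pred {set P * P}) : x \in mins S ->
  #|[set L in exts S | first_in S x L && Q L]| =
  #|[set L in exts (S :\ x) | Q (cons_ext S x L)]|.
Proof.
move=> xm; have [xS _] := minsP _ _ xm.
have inj : {in [set L in exts (S :\ x) | Q (cons_ext S x L)] &,
             injective (cons_ext S x)}.
  move=> L1 L2; rewrite !inE => /andP[/lin_onP[S1 _ _ _ _] _].
  move=> /andP[/lin_onP[S2 _ _ _ _] _] /setP eL; apply/setP=> -[y z].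
  have := eL (y, z); rewrite !inE /=.
  have [->|yx] := eqVneq y x; last by rewrite !orbF.
  have out T : (forall y z, (y, z) \in T -> y \in S :\ x /\ z \in S :\ x) ->
      ((x, z) \in T) = false.
    by move=> TS; apply/negP => /TS[]; rewrite !inE eqxx.
  by rewrite !out.
rewrite -(card_in_imset inj); apply: eq_card => L; rewrite !inE.
apply/idP/imsetP.
  case/and3P=> linL /forall_inP xf QL.
  have eL : L = cons_ext S x (L :&: setX (S :\ x) (S :\ x)).
    case/lin_onP: linL => LS le_L asym tr tot.
    apply/setP=> -[y z]; rewrite !inE /=.
    case: (boolP ((y, z) \in L)) => [yz|nyz] /=.
      have [yS zS] := LS _ _ yz; rewrite yS zS !andbT /=.
      have [_|yx] /= := eqVneq y x; first by [].
      rewrite orbF; apply/esym/eqP => zx; subst z.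
      by case/eqP: yx; apply: asym; rewrite // xf.
    have [yx|//] := eqVneq y x; subst y.
    by apply/esym/negbTE; apply: contra nyz; apply: xf.
  exists (L :&: setX (S :\ x) (S :\ x)) => //.
  rewrite !inE -eL QL andbT.
  case/lin_onP: linL => LS le_L asym tr tot; apply/lin_onP; split.
  + by move=> y z; rewrite in_setI in_setX => /andP[_ /andP].
  + move=> y z yS zS yz; rewrite in_setI in_setX yS zS /= andbT.
    by apply: le_L => //; [case/setD1P: yS | case/setD1P: zS].
  + by move=> y z; rewrite in_setI => /andP[yz _] /setIP[zy _]; apply: asym.
  + move=> y z t /setIP[yz]; rewrite !inE => /= /andP[/andP[yx yS] _].
    case/andP=> zt /andP[_ /andP[tx tS]].
    by rewrite (tr _ _ _ yz zt) yx yS tx tS.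
  + move=> y z yS zS; rewrite !in_setI !in_setX yS zS /= !andbT.
    by apply: tot; [case/setD1P: yS | case/setD1P: zS].
case=> L'; rewrite !inE => /andP[linL' QL'] ->; rewrite QL' andbT.
rewrite cons_ext_lin //=; apply/forall_inP=> y yS.
by rewrite !inE /= eqxx yS orbT.
Qed.

Lemma num_rec S : S != set0 -> num S = \sum_(x in mins S) num (S :\ x).
Proof.
move=> S0; transitivity #|[set L in exts S | predT L]|.
  by apply: eq_card => L; rewrite !inE andbT.
rewrite card_exts_first //; apply: eq_bigr => x xm; rewrite card_exts_cons //.
by apply: eq_card => L; rewrite !inE andbT.
Qed.

Lemma num_lt_rec S u v : u \in S -> v \in S -> u != v ->
  num_lt S u v = \sum_(x in mins S)
    (if x == u then num (S :\ x) else
     if x == v then 0 else num_lt (S :\ x) u v).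
Proof.
move=> uS vS uv; rewrite /num_lt card_exts_first; last first.
  by apply/set0Pn; exists u.
apply: eq_bigr => x xm; rewrite card_exts_cons //.
have [xu|xu] := eqVneq x u.
  by apply: eq_card => L; rewrite !inE /= eq_sym xu eqxx vS orbT andbT.
have [xv|xv] := eqVneq x v.
  apply: eq_card0 => L; rewrite !inE /= [u == x]eq_sym (negPf xu) orbF.
  apply/negP=> /andP[/lin_onP[LS _ _ _ _] /LS[_]].
  by rewrite !inE xv eqxx.
by apply: eq_card => L; rewrite !inE /= [u == x]eq_sym (negPf xu) orbF.
Qed.

Lemma num_set0 : num set0 = 1%N.
Proof.
rewrite /num (_ : exts set0 = [set set0]) ?cards1 //.
apply/setP=> L; rewrite !inE; apply/lin_onP/eqP => [[LS _ _ _ _]|->].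
  apply/setP=> -[x y]; rewrite inE; apply/negP=> /LS[].
  by rewrite inE.
by split=> [x y|x y|x y|x y z|x y]; rewrite !inE.
Qed.

Lemma num_gt0 S : 0 < num S.
Proof.
have [n] := ubnP #|S|; elim: n S => // n IHn S leSn.
have [->|S0] := eqVneq S set0; first by rewrite num_set0.
rewrite num_rec //; have /set0Pn[x xm] := mins_neq0 S0.
rewrite (bigD1 x) //= ltn_addr // IHn // -ltnS.
by apply: leq_trans leSn; rewrite ltnS (cardsD1 x S); case/minsP: xm => ->.
Qed.

Lemma num_ltC S u v : u \in S -> v \in S -> u != v ->
  num_lt S u v + num_lt S v u = num S.
Proof.
move=> uS vS uv; rewrite /num_lt /num -cardsUI.
set X := _ :|: _; set Y := _ :&: _.
have -> : Y = set0.
  apply/setP=> L; rewrite !inE; apply/negP.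
  case/andP=> /andP[/lin_onP[_ _ asym _ _] uv_L] /andP[_ vu_L].
  by move/eqP: uv; apply; apply: asym.
rewrite cards0 addn0; apply: eq_card => L; rewrite !inE -andb_orr.
case: (boolP (lin_on S L)) => //= /lin_onP[_ _ _ _ tot].
exact/orP/tot.
Qed.

Definition all_below D S := {in D & S, forall x y, (x < y)%O}.

Lemma mins_sum D S : all_below D S -> D != set0 -> mins (D :|: S) = mins D.
Proof.
move=> DS /set0Pn[z zD]; apply/setP=> x; apply/minsP/minsP => -[xDS xmin].
  have xD : x \in D.
    case/setUP: xDS => // xS; have := xmin z; rewrite inE zD => /(_ isT).
    by rewrite DS.
  by split=> // y yD; apply: xmin; rewrite inE yD.
split=> [|y]; first by rewrite inE xDS.
case/setUP=> [|yS]; first exact: xmin.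
by rewrite lt_gtF // DS.
Qed.

End RelativeExtensions.

(** * Direct sums and blocks inside a poset *)

Section Sums.
Context {d : Order.disp_t} {P : finPOrderType d}.
Implicit Types (S D : {set P}) (L : {set P * P}).

Lemma all_below_disjoint D S x : all_below D S -> x \in D -> x \notin S.
Proof. by move=> DS xD; apply/negP=> /(DS x x xD); rewrite ltxx. Qed.

Lemma setU_D1 D S x : x \notin S -> (D :|: S) :\ x = (D :\ x) :|: S.
Proof.
move=> xS; apply/setP=> y; rewrite !inE.
by case: eqP => //= ->; rewrite (negPf xS).
Qed.

Lemma all_below_D1 D S x : all_below D S -> all_below (D :\ x) S.
Proof. by move=> DS y z /setD1P[_ yD]; apply: DS. Qed.

(** While [D] is nonempty the minimal elements all lie in [D], so the recursion on minimal elements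
    consumes [D] before touching [S]. *)
Lemma num_sum D S : all_below D S -> num (D :|: S) = num D * num S.
Proof.
have [n] := ubnP #|D|; elim: n D => // n IHn D leDn DS.
have [->|D0] := eqVneq D set0; first by rewrite set0U num_set0 mul1n.
have DS0 : D :|: S != set0.
  by case/set0Pn: D0 => x xD; apply/set0Pn; exists x; rewrite inE xD.
rewrite (num_rec DS0) (num_rec D0) mins_sum // big_distrl /=.
apply: eq_bigr => x /minsP[xD _].
rewrite setU_D1 ?(all_below_disjoint DS) // IHn //; last exact: all_below_D1.
by move: leDn; rewrite (cardsD1 x) xD.
Qed.

Lemma num_lt_sum D S u v : all_below D S -> u \in S -> v \in S -> u != v ->
  num_lt (D :|: S) u v = num D * num_lt S u v.
Proof.
move=> + uS vS uv.
have [n] := ubnP #|D|; elim: n D => // n IHn D leDn DS.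
have [->|D0] := eqVneq D set0; first by rewrite set0U num_set0 mul1n.
rewrite num_lt_rec ?inE ?uS ?vS ?orbT // (num_rec D0) mins_sum // big_distrl /=.
apply: eq_bigr => x /minsP[xD _].
have xS := all_below_disjoint DS xD.
rewrite !ifN; try by apply: contraNneq xS => ->.
rewrite setU_D1 // IHn //; last exact: all_below_D1.
by move: leDn; rewrite (cardsD1 x) xD.
Qed.

Definition E_triple D := exists a b c,
  [/\ D = [set a; b; c], (a < b)%O, (a >< c)%O & (b >< c)%O].

Inductive block_set : {set P} -> Prop :=
| Block_set1 x : block_set [set x]
| Block_setE D : E_triple D -> block_set D.

(** Direct sums of blocks are tracked as subsets of [P], so that the induction needs no
    isomorphisms; [blocky_embed] produces one at the end. *)
Inductive blocky : {set P} -> Prop :=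
| Blocky_one D : block_set D -> blocky D
| Blocky_add D S : block_set D -> all_below D S -> blocky S ->
    blocky (D :|: S).

Lemma block_set_embed D : block_set D -> exists (b : block)
  (f : block_poset b -> P), {mono f : x y / (x <= y)%O} /\ f @: setT = D.
Proof.
case=> {D} [x|D [a [b [c [-> ab ac bc]]]]].
  exists block_1, (fun=> x); split.
    by move=> y z; rewrite lexx; apply/esym; rewrite !ord1.
  apply/setP=> y; rewrite inE; apply/imsetP/eqP => [[]//|->].
  by exists ord0.
have [ac1 ac2] : (a <= c)%O = false /\ (c <= a)%O = false.
  by move: ac; rewrite /Order.comparable negb_or => /andP[/negPf-> /negPf->].
have [bc1 bc2] : (b <= c)%O = false /\ (c <= b)%O = false.
  by move: bc; rewrite /Order.comparable negb_or => /andP[/negPf-> /negPf->].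
exists block_E, (fun i : 'I_3 => nth a [:: a; b; c] i); split.
  move=> x y; change (nth a [:: a; b; c] x <= nth a [:: a; b; c] y
    = poset_E_le x y)%O; rewrite /poset_E_le -val_eqE.
  case: x y => [[|[|[|x]]] //= _] [[|[|[|y]]] //= _];
    rewrite ?lexx ?ac1 ?ac2 ?bc1 ?bc2 ?(ltW ab) ?(lt_geF ab) //.
apply/setP=> y; rewrite !inE; apply/imsetP/idP => [[[[|[|[|i]]] //= _] _ ->]|].
- by rewrite eqxx.
- by rewrite eqxx orbT.
- by rewrite eqxx !orbT.
case/orP=> [/orP[]|] /eqP->.
- by exists (@Ordinal 3 0 isT).
- by exists (@Ordinal 3 1 isT).
- by exists (@Ordinal 3 2 isT).
Qed.

Lemma blocky_embed S : blocky S -> exists (b : block) (s : seq block)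
  (f : block_sum b s -> P), {mono f : x y / (x <= y)%O} /\ f @: setT = S.
Proof.
elim=> [D|{}D {}S] /block_set_embed[b [f [f_mono fD]]].
  by exists b, [::], f.
move=> DS _ [b' [s [g [g_mono gS]]]].
exists b, (b' :: s),
  (fun x : block_poset b + block_sum b' s =>
     match x with inl y => f y | inr y => g y end); split.
  have fgD y z : (f y < g z)%O.
    by apply: DS; rewrite -?fD -?gS imset_f.
  move=> [x|x] [y|y]; rewrite ?f_mono ?g_mono //.
    by rewrite (ltW (fgD x y)).
  by rewrite lt_geF.
apply/setP=> y; rewrite inE -fD -gS; apply/imsetP/orP.
  by case=> [[x|x] _ ->]; [left | right]; rewrite imset_f.
by case=> /imsetP[x _ ->]; [exists (inl x) | exists (inr x)].
Qed.

Lemma blocky_sum_of_1_and_E : blocky setT -> sum_of_1_and_E P.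
Proof.
case/blocky_embed=> b [s [f [f_mono fT]]]; exists b, s.
have f_inj : injective f := mono_inj lexx le_anti f_mono.
have [g gf fg] : bijective f.
  apply: (inj_card_bij f_inj).
  by rewrite -(cardsT P) -fT (leq_trans (leq_imset_card _ _)) // cardsT.
exists g; first by exists f.
by move=> x y; rewrite -f_mono !fg.
Qed.

End Sums.

(** * Covering a poset of width at most 2 by two chains *)

Section TwoChains.
Context {d : Order.disp_t} {P : finPOrderType d}.
Implicit Types (S C X : {set P}).

Definition chain C : Prop := {in C &, forall x y, (x >=< y)%O}.

Lemma chain_max C : chain C -> C != set0 ->
  exists2 t, t \in C & {in C, forall x, (x <= t)%O}.
Proof.
move=> chC /set0Pn[x0 x0C].
case: (arg_maxnP (fun t => #|[set x in C | (x <= t)%O]|) x0C) => t tC tmax.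
exists t => // x xC; case/orP: (chC x t xC tC) => // tx.
have sub : [set y in C | (y <= t)%O] \subset [set y in C | (y <= x)%O].
  by apply/subsetP=> y; rewrite !inE => /andP[-> /le_trans ->].
have /setP/(_ x) : [set y in C | (y <= t)%O] = [set y in C | (y <= x)%O].
  by apply/eqP; rewrite eqEcard sub; apply: tmax.
by rewrite !inE xC lexx.
Qed.

Hypothesis no3 : forall x y z : P,
  (x >< y)%O -> (y >< z)%O -> (x >< z)%O -> False.

(* If [a] is minimal, the elements incomparable to [a] form a chain [X].      *)
(* Its largest element lies in one of the two chains of the rest, and below   *)
(* all the elements of that chain that are above [a]: so the part of that     *)
(* chain above [a] can be put on top of [X], and the other one on top of [a]. *)
Lemma two_chain_cover S :
  exists C1 C2, [/\ chain C1, chain C2 & S = C1 :|: C2].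
Proof.
have [n] := ubnP #|S|; elim: n S => // n IHn S leSn.
have [->|S0] := eqVneq S set0.
  by exists set0, set0; rewrite setU0; split=> // x y; rewrite inE.
have /set0Pn[a am] := mins_neq0 S0; have [aS amin] := minsP _ _ am.
have [|C1 [C2 [ch1 ch2 S12]]] := IHn (S :\ a).
  by move: leSn; rewrite (cardsD1 a) aS.
pose X := [set x in S | (a >< x)%O]; pose U := [set x in S | (a < x)%O].
have chX : chain X.
  move=> x y; rewrite !inE => /andP[_ ax] /andP[_ ay].
  by apply/negPn/negP => xy; apply: (no3 ax xy ay).
have SXU : S = a |: (X :|: U).
  apply/setP=> x; rewrite !inE; have [->|xa] := eqVneq x a; first by rewrite aS.
  case: (boolP (x \in S)) => //= xS; rewrite lt_neqAle eq_sym xa /=.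
  rewrite /Order.comparable negb_or.
  have -> : (x <= a)%O = false.
    by apply/negP=> xle; have := amin x xS; rewrite lt_neqAle xa xle.
  by rewrite andbT; case: (a <= x)%O.
have UinC x : x \in U -> (x \in C1) || (x \in C2).
  move=> xU; rewrite -in_setU -S12 !inE; move: xU; rewrite inE.
  by case/andP=> -> /gt_eqF ->.
have cover D1 D2 : chain D1 -> chain D2 -> S :\ a = D1 :|: D2 ->
    {in X & D1 :&: U, forall x u, (x <= u)%O} ->
    exists C1 C2, [/\ chain C1, chain C2 & S = C1 :|: C2].
  move=> c1 c2 SD low; exists (X :|: (D1 :&: U)), (a |: (D2 :&: U)); split.
  - move=> x y /setUP[xX|xU] /setUP[yX|yU]; first exact: chX.
    + by apply/orP; left; apply: low.
    + by apply/orP; right; apply: low.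
    + by case/setIP: xU => xD _; case/setIP: yU => yD _; apply: c1.
  - move=> x y /setU1P[->|/setIP[xD xU]] /setU1P[->|/setIP[yD yU]].
    + by rewrite /Order.comparable lexx.
    + by move: yU; rewrite inE => /andP[_ /ltW ay]; apply/orP; left.
    + by move: xU; rewrite inE => /andP[_ /ltW ax]; apply/orP; right.
    + exact: c2.
  - apply/setP=> x; rewrite [in LHS]SXU.
    have /setP/(_ x) := SD; rewrite !inE.
    have [->|xa] /= := eqVneq x a; first by rewrite ?orbT.
    by case: (x \in S); case: (x \in D1); case: (x \in D2);
       case: (a < x)%O; case: (a >< x)%O.
have [X0|X0] := eqVneq X set0.
  by apply: (cover C1 C2) => // x y; rewrite X0 inE.
have [t tX tmax] := chain_max chX X0.
have low D1 D2 : chain D1 -> S :\ a = D1 :|: D2 -> t \in D1 ->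
    {in X & D1 :&: U, forall x u, (x <= u)%O}.
  move=> c1 SD tD x u xX /setIP[uD]; rewrite inE => /andP[_ au].
  apply: le_trans (tmax x xX) _; case/orP: (c1 t u tD uD) => // ut.
  move: tX; rewrite inE /Order.comparable negb_or => /and3P[_ /negP[]].
  exact: le_trans (ltW au) ut.
have : t \in C1 :|: C2.
  rewrite -S12 !inE; move: tX; rewrite inE => /andP[-> at_]; rewrite andbT.
  by apply: contraNneq at_ => ->; rewrite /Order.comparable lexx.
case/setUP=> tC; first exact: (cover C1 C2 ch1 ch2 S12 (low _ _ ch1 S12 tC)).
rewrite setUC in S12.
exact: (cover C2 C1 ch2 ch1 S12 (low _ _ ch2 S12 tC)).
Qed.

Lemma chain_sorted C : chain C -> exists2 s : seq P, sorted <%O s & s =i C.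
Proof.
move=> chC; exists (sort <=%O (enum C)); last first.
  by move=> x; rewrite mem_sort mem_enum.
rewrite lt_sorted_uniq_le sort_uniq enum_uniq /=.
apply: (@sort_sorted_in _ (mem C)).
  by move=> x y xC yC; apply: chC.
by apply/allP=> x; rewrite mem_enum.
Qed.

Lemma two_sorted_cover S : exists A B : seq P,
  [/\ sorted <%O A, sorted <%O B, uniq (A ++ B) & S = [set x in A ++ B]].
Proof.
have [C1 [C2 [ch1 ch2 ->]]] := two_chain_cover S.
have [A sA AC] := chain_sorted ch1.
have [|B sB BC] := @chain_sorted (C2 :\: C1).
  by move=> x y /setDP[xC _] /setDP[yC _]; apply: ch2.
exists A, B; split=> //.
  rewrite cat_uniq !(sorted_uniq lt_trans ltxx) // andbT /=.
  by apply/hasPn=> x; rewrite BC AC => /setDP[].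
by apply/setP=> x; rewrite !inE mem_cat AC BC inE; case: (x \in C1).
Qed.

End TwoChains.

(** * Lower sets as grid points, linear extensions as lattice paths *)

Section Grid.
Context {d : Order.disp_t} {P : finPOrderType d}.
Implicit Types (A B : seq P) (i j k l : nat).

(* [(i, j)] stands for the set of the first [i] elements of [A] and the first *)
(* [j] elements of [B]; [valid A B i j] says that it is a lower set.          *)
Definition noback A B i j : bool :=
  all (fun x => all (fun y => ~~ (y < x)%O) (drop j B)) (take i A).

Definition valid A B i j : bool :=
  [&& i <= size A, j <= size B, noback A B i j & noback B A j i].

Definition rest A B i j : {set P} := [set x in drop i A ++ drop j B].

(** The factor makes the count vanish off the lower sets, so that both neighbours can be added
    without a case distinction. *)
Definition paths A B i j : nat := valid A B i j * num (rest A B i j).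

Lemma validC A B i j : valid A B i j = valid B A j i.
Proof. by rewrite /valid andbCA [noback A B i j && _]andbC. Qed.

Lemma restC A B i j : rest A B i j = rest B A j i.
Proof. by apply/setP=> x; rewrite !inE !mem_cat orbC. Qed.

Lemma pathsC A B i j : paths A B i j = paths B A j i.
Proof. by rewrite /paths validC restC. Qed.

Lemma mem_take_leq (s : seq P) i i' : i <= i' -> {subset take i s <= take i' s}.
Proof. by move=> le x; rewrite -(subnKC le) takeD mem_cat => ->. Qed.

Lemma mem_drop_leq (s : seq P) i i' : i <= i' -> {subset drop i' s <= drop i s}.
Proof. by move=> le x; rewrite -(subnK le) -drop_drop => /mem_drop. Qed.

Lemma noback_mono A B i j i' j' : i' <= i -> j <= j' ->
  noback A B i j -> noback A B i' j'.
Proof.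
move=> ii jj /allP nb; apply/allP=> x /(mem_take_leq ii) /nb /allP nbx.
by apply/allP=> y /(mem_drop_leq jj) /nbx.
Qed.

Lemma noback0 A B j : noback A B 0 j.
Proof. by rewrite /noback take0. Qed.

Lemma valid00 A B : valid A B 0 0.
Proof. by rewrite /valid !noback0. Qed.

Lemma sorted_drop_lt (x0 : P) (s : seq P) i : sorted <%O s -> i < size s ->
  {in drop i.+1 s, forall y, (nth x0 s i < y)%O}.
Proof.
move=> /(drop_sorted i) + ltis; rewrite (drop_nth x0 ltis) /=.
by move/(order_path_min lt_trans)/allP.
Qed.

Section Chains.
Variables (A B : seq P) (x0 : P).
Hypotheses (sA : sorted <%O A) (sB : sorted <%O B) (uAB : uniq (A ++ B)).

Lemma rest_D1 i j : i < size A ->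
  rest A B i j :\ nth x0 A i = rest A B i.+1 j.
Proof.
move=> lti; apply/setP=> x; rewrite !inE (drop_nth x0 lti) /= inE.
have [->|//] := eqVneq x; apply/esym/negbTE.
rewrite mem_cat negb_or; apply/andP; split.
  by apply/negP=> /(sorted_drop_lt x0 sA lti); rewrite ltxx.
move: uAB; rewrite cat_uniq => /and3P[_ /hasPn AB _].
by apply/negP=> /mem_drop /AB /=; rewrite mem_nth.
Qed.

(** What is left of [A] is a chain, so only its first element can be minimal, and it is minimal
    exactly when adding it yields a lower set. *)
Lemma mins_restl i j x : valid A B i j -> x \in drop i A ->
  (x \in mins (rest A B i j)) =
  [&& i < size A, valid A B i.+1 j & x == nth x0 A i].
Proof.
move=> /and4P[_ lej nAB nBA] xi.
have lti : i < size A.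
  by rewrite ltnNge; apply: contraL xi => /drop_oversize->.
rewrite lti /=; apply/minsP/andP => [[_ xmin]|[/and4P[_ _ nAB' _] /eqP xE]].
  have xE : x = nth x0 A i.
    move: xi; rewrite (drop_nth x0 lti) inE => /predU1P[//|].
    move/(sorted_drop_lt x0 sA lti) => ax; have := xmin (nth x0 A i).
    by rewrite inE (drop_nth x0 lti) /= inE eqxx ax => /(_ isT).
  split; last by rewrite xE.
  rewrite /valid lti lej (noback_mono (leqnn _) _ nBA) ?andbT //=.
  rewrite /noback (take_nth x0 lti) all_rcons -xE.
  apply/andP; split; last exact: nAB.
  by apply/allP=> y yB; apply: xmin; rewrite inE mem_cat yB orbT.
split=> [|y]; first by rewrite inE mem_cat xi.
rewrite inE mem_cat xE => /orP[|yB].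
  rewrite (drop_nth x0 lti) inE => /predU1P[->|]; first by rewrite ltxx.
  by move/(sorted_drop_lt x0 sA lti)/lt_gtF->.
move/allP: nAB' => /(_ (nth x0 A i)); rewrite (take_nth x0 lti) mem_rcons.
by rewrite mem_head => /(_ isT) /allP; apply.
Qed.

End Chains.

Section Recursion.
Variables (A B : seq P) (x0 : P).
Hypotheses (sA : sorted <%O A) (sB : sorted <%O B) (uAB : uniq (A ++ B)).

Lemma validS_lt i j : valid A B i.+1 j -> i < size A.
Proof. by case/and4P. Qed.

Lemma nth_neq i j : i < size A -> j < size B -> nth x0 A i != nth x0 B j.
Proof.
move=> lti ltj; move: uAB; rewrite cat_uniq => /and3P[_ /hasPn AB _].
by apply: contraNneq (AB _ (mem_nth x0 ltj)) => <-; rewrite /= mem_nth.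
Qed.

Lemma sum_mins_rest i j (F : P -> nat) : valid A B i j ->
  \sum_(x in mins (rest A B i j)) F x =
  valid A B i.+1 j * F (nth x0 A i) + valid A B i j.+1 * F (nth x0 B j).
Proof.
move=> vij; have vji : valid B A j i by rewrite validC.
have memE x : (x \in mins (rest A B i j)) =
    (valid A B i.+1 j && (x == nth x0 A i)) ||
    (valid A B i j.+1 && (x == nth x0 B j)).
  apply/idP/idP => [xm|].
    have [xr _] := minsP _ _ xm; move: xr; rewrite inE mem_cat => /orP[]xi.
      by move: xm; rewrite (mins_restl x0) // => /and3P[_ -> ->].
    move: xm; rewrite restC (mins_restl x0 sB vji) // => /and3P[_].
    by rewrite validC => -> ->; rewrite orbT.
  case/orP=> /andP[v /eqP->].
    have lti := validS_lt v.
    by rewrite (mins_restl x0) ?lti ?v ?eqxx // (drop_nth x0 lti) mem_head.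
  have ltj : j < size B by case/and4P: v.
  rewrite restC (mins_restl x0 sB vji).
    by rewrite ltj validC v eqxx.
  by rewrite (drop_nth x0 ltj) mem_head.
rewrite (eq_bigl _ _ memE).
case: (boolP (valid A B i.+1 j)) => v1;
  case: (boolP (valid A B i j.+1)) => v2 /=.
- have lti := validS_lt v1; have ltj : j < size B by case/and4P: v2.
  have ab := nth_neq lti ltj.
  rewrite (bigD1 (nth x0 A i)) ?eqxx //= (bigD1 (nth x0 B j)); last first.
    by rewrite eqxx orbT eq_sym ab.
  rewrite big1 /= => [|x /andP[/andP[/orP[]]]]; first by rewrite addn0 !mul1n.
    by move=> /eqP->; rewrite eqxx.
  by move=> /eqP->; rewrite eqxx.
- by under eq_bigl do rewrite orbF; rewrite big_pred1_eq mul1n addn0.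
- by rewrite big_pred1_eq mul1n.
- by rewrite big_pred0.
Qed.

Lemma rest_neq0 i j : (i < size A) || (j < size B) -> rest A B i j != set0.
Proof.
move=> ij; apply/set0Pn; case/orP: ij => lt.
  by exists (nth x0 A i); rewrite inE mem_cat (drop_nth x0 lt) mem_head.
by exists (nth x0 B j); rewrite inE mem_cat (drop_nth x0 lt) mem_head orbT.
Qed.

Lemma paths_rec i j : (i < size A) || (j < size B) ->
  paths A B i j = valid A B i j * (paths A B i.+1 j + paths A B i j.+1).
Proof.
move=> ij; rewrite {1}/paths; case: (boolP (valid A B i j)) => // vij.
rewrite num_rec ?rest_neq0 // sum_mins_rest //; congr (_ * (_ + _)).
  rewrite /paths; case: (boolP (valid A B i.+1 j)) => // v.
  by rewrite rest_D1 ?(validS_lt v).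
rewrite /paths; case: (boolP (valid A B i j.+1)) => // v.
have ltj : j < size B by case/and4P: v.
by rewrite restC rest_D1 // 1?uniq_catC // restC.
Qed.

(* The number of paths from [(i, l)] on which the [j]-th element of [B] comes *)
(* before the [k]-th element of [A] (counted from 0).                         *)
Definition paths_lt j k i l : nat :=
  valid A B i l * num_lt (rest A B i l) (nth x0 B j) (nth x0 A k).

(** Taking the [k]-th element of [A] first leaves nothing to count; taking the [j]-th element of [B]
    first settles the comparison, and every remaining path counts. *)
Lemma paths_lt_rec j k i l : j < size B -> k < size A -> l <= j -> i <= k ->
  paths_lt j k i l = valid A B i l *
    ((if i < k then paths_lt j k i.+1 l else 0) +
     (if l < j then paths_lt j k i l.+1 else paths A B i j.+1)).
Proof.
move=> ltj ltk lej lek; rewrite {1}/paths_lt.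
case: (boolP (valid A B i l)) => // vil.
have nth_drop_mem (s : seq P) p q : p <= q -> q < size s ->
    nth x0 s q \in drop p s.
  move=> pq qs; rewrite -{1}(subnKC pq) -nth_drop mem_nth // size_drop.
  by rewrite ltn_sub2r // (leq_ltn_trans pq).
have ba := nth_neq ltk ltj.
rewrite num_lt_rec ?inE ?mem_cat ?nth_drop_mem ?orbT 1?eq_sym //.
have lti : i < size A := leq_ltn_trans lek ltk.
have ltl : l < size B := leq_ltn_trans lej ltj.
have uniqA : uniq A by rewrite (sorted_uniq lt_trans ltxx).
have uniqB : uniq B by rewrite (sorted_uniq lt_trans ltxx).
rewrite sum_mins_rest //; congr (_ * (_ + _)).
  rewrite (negPf (nth_neq lti ltj)) nth_uniq // rest_D1 //.
  by move: lek; rewrite leq_eqVlt /paths_lt; case: eqP => [->|_ /= ->];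
     rewrite ?ltnn ?muln0.
rewrite nth_uniq // [nth x0 B l == _]eq_sym (negPf (nth_neq ltk ltl)).
rewrite restC rest_D1 // 1?uniq_catC // restC.
by move: lej; rewrite leq_eqVlt /paths_lt /paths; case: eqP => [->|_ /= ->];
   rewrite ?ltnn.
Qed.

End Recursion.
End Grid.

(** * Log-concavity, and cutting paths where they leave a row *)

Section PathCounts.
Context {d : Order.disp_t} {P : finPOrderType d}.
Implicit Types (A B : seq P) (i j k l : nat).

Definition two_chains A B : bool :=
  [&& sorted <%O A, sorted <%O B & uniq (A ++ B)].

Lemma two_chainsC A B : two_chains A B = two_chains B A.
Proof. by rewrite /two_chains uniq_catC andbCA. Qed.

Lemma two_chains_paths_rec A B i j : two_chains A B ->
  (i < size A) || (j < size B) ->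
  paths A B i j = valid A B i j * (paths A B i.+1 j + paths A B i j.+1).
Proof.
case/and3P=> sA sB uAB ij; suff x0 : P by apply: (paths_rec x0).
by move: ij; case: A B {sA sB uAB} => [|x s] [|y t].
Qed.

Lemma paths_gt0_valid A B i j : 0 < paths A B i j -> valid A B i j.
Proof. by rewrite /paths; case: valid. Qed.

Lemma paths_invalid A B i j : ~~ valid A B i j -> paths A B i j = 0.
Proof. by rewrite /paths => /negPf->. Qed.

Lemma invalid_size A B i j : size A < i -> ~~ valid A B i j.
Proof. by rewrite /valid ltnNge => /negPf->. Qed.

Lemma paths_decrl A B i j : two_chains A B -> valid A B i j ->
  paths A B i.+1 j <= paths A B i j.
Proof.
move=> AB vij; case: (boolP ((i < size A) || (j < size B))) => [ij|].
  by rewrite [X in _ <= X]two_chains_paths_rec // vij mul1n leq_addr.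
rewrite negb_or -leqNgt => /andP[lei _].
by rewrite paths_invalid // invalid_size.
Qed.

(* Move the first path up by one step: it then starts below and ends above    *)
(* the second one, so the two paths meet, and can exchange their tails.       *)
Lemma paths_log_concave A B i j i' k : two_chains A B -> i' <= i -> j <= k ->
  paths A B i j * paths A B i' k.+1 <= paths A B i j.+1 * paths A B i' k.
Proof.
move=> AB; have [p] := ubnP (((size A).+1 - i') + ((size A).+1 - i) +
  (size B - k) + (size B - j)).
elim: p i j i' k => // p IHp i j i' k ltp ii jk.
case: (posnP (paths A B i j)) => [-> //|/paths_gt0_valid v1].
case: (posnP (paths A B i' k.+1)) => [->|/paths_gt0_valid v2].
  by rewrite muln0.
have [lei lej n1 m1] := and4P v1; have [lei' ltk n2 m2] := and4P v2.
have [ltii|] := ltnP i' i.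
  have lti' : i' < size A := leq_trans ltii lei.
  have v3 : valid A B i' k.
    rewrite /valid lei' (ltnW ltk) (noback_mono ii jk n1).
    exact: noback_mono (leqnSn k) (leqnn i') m2.
  rewrite (two_chains_paths_rec (i := i') (j := k.+1)) ?lti' //.
  rewrite (two_chains_paths_rec (i := i') (j := k)) ?lti' //.
  rewrite v2 v3 !mul1n !mulnDr leq_add // IHp //.
  - by clear -ltp lti'; lia.
  - by clear -ltp ltk; lia.
  - by rewrite leqW.
move=> lei2; have ei : i' = i by apply/eqP; rewrite eqn_leq ii.
subst i'; have [ltjk|] := ltnP j k; last first.
  move=> lekj; have -> : j = k by apply/eqP; rewrite eqn_leq jk.
  by rewrite mulnC.
have ltj : j.+1 < size B := leq_ltn_trans ltjk ltk.
have v3 : valid A B i j.+1.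
  rewrite /valid lei (ltnW ltj) (noback_mono (leqnn i) (leqnSn j) n1).
  by apply: noback_mono m2 => //; apply: leqW.
rewrite (two_chains_paths_rec (i := i) (j := j.+1)) ?ltj ?orbT //.
rewrite (two_chains_paths_rec (i := i) (j := j)) ?(ltnW ltj) ?orbT //.
rewrite v1 v3 !mul1n !mulnDl leq_add // IHp //.
- by clear -ltp lei; lia.
- by clear -ltp ltj; lia.
Qed.

(** Pushes weights along one row: [c i] enters at [i] from the previous row, the recursive term
    arrives from [i - 1], and both are lost where [v] fails. *)
Fixpoint sweep (v : nat -> bool) (c : nat -> nat) i : nat :=
  v i * (c i + if i is i'.+1 then sweep v c i' else 0).

Definition source i : nat := i == 0.

(* [paths_to A B j i] is the number of paths from [(0, 0)] to [(i, j)].       *)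
Fixpoint paths_to A B j : nat -> nat :=
  sweep (valid A B ^~ j) (if j is j'.+1 then paths_to A B j' else source).

(** [sweep] is the transpose of the recursion for [F]: moving from one row to the next preserves the
    weighted sum. *)
Lemma sum_sweep (v : nat -> bool) (c F G : nat -> nat) k :
    (forall i, i <= k -> F i = v i * (F i.+1 + G i)) -> F k.+1 = 0 ->
  \sum_(i < k.+1) c i * F i = \sum_(i < k.+1) sweep v c i * G i.
Proof.
move=> FG Fk.
(* The last term is the weight still travelling along the row; it disappears at the end because
   [F k.+1 = 0]. *)
have main t : t <= k -> \sum_(i < t.+1) c i * F i =
    \sum_(i < t.+1) sweep v c i * G i + sweep v c t * F t.+1.
  elim: t => [|t IHt] let_.
    rewrite !big_ord_recl !big_ord0 FG //=; case: (v 0) => /=; last by lia.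
    by rewrite !addn0 !mul1n; nia.
  rewrite big_ord_recr [in RHS]big_ord_recr /= IHt 1?ltnW // (FG t.+1) //.
  by case: (v t.+1) => /=; rewrite ?mul0n ?mul1n; nia.
by rewrite main // Fk muln0 addn0.
Qed.

(** A path passes from row [j] to row [j.+1] exactly once; it is cut at that step. *)
Lemma sum_paths_to A B j k (F : nat -> nat -> nat) :
    (forall i l, l <= j -> i <= k ->
       F l i = valid A B i l * (F l i.+1 + F l.+1 i)) ->
    (forall l, l <= j -> F l k.+1 = 0) ->
  F 0 0 = \sum_(i < k.+1) paths_to A B j i * F j.+1 i.
Proof.
move=> FE Fk; pose c l := if l is l'.+1 then paths_to A B l' else source.
have main l : l <= j.+1 -> F 0 0 = \sum_(i < k.+1) c l i * F l i.
  elim: l => [|l IHl] lel.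
    by rewrite big_ord_recl /= mul1n big1 ?addn0 // => i _; rewrite mul0n.
  rewrite IHl 1?ltnW //.
  rewrite (@sum_sweep (valid A B ^~ l) _ _ (F l.+1)) //; last exact: Fk.
    by apply: eq_bigr => i _; case: l {IHl} lel.
  by move=> i lei; apply: FE.
by rewrite (main j.+1).
Qed.

Lemma paths00_sum A B j : two_chains A B -> j < size B ->
  paths A B 0 0 = \sum_(i < (size A).+1) paths_to A B j i * paths A B i j.+1.
Proof.
move=> AB ltj.
apply: (@sum_paths_to A B j (size A) (fun l i => paths A B i l))
  => [i l lel _|l _].
  by apply: two_chains_paths_rec; rewrite // (leq_ltn_trans lel ltj) orbT.
by rewrite paths_invalid // invalid_size.
Qed.

Lemma num_lt_sum_paths (x0 : P) A B j k :
    two_chains A B -> j < size B -> k < size A ->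
  num_lt [set x in A ++ B] (nth x0 B j) (nth x0 A k) =
  \sum_(i < k.+1) paths_to A B j i * paths A B i j.+1.
Proof.
move=> AB ltj ltk; have /and3P[sA sB uAB] := AB.
(* A path past column [k] in the rows up to [j] has taken the [k]-th element of [A] too early and
   counts 0; one that has reached row [j.+1] in time counts fully. *)
pose F l i := if i <= k then
  (if l <= j then paths_lt A B x0 j k i l else paths A B i j.+1) else 0.
have F00 : F 0 0 = num_lt [set x in A ++ B] (nth x0 B j) (nth x0 A k).
  by rewrite /F /= /paths_lt valid00 mul1n /rest !drop0.
rewrite -F00 (@sum_paths_to A B j k F) => [|i l lel lei|l _].
- by apply: eq_bigr => i _; rewrite /F ltnn -ltnS ltn_ord.
- by rewrite /F lel lei paths_lt_rec.
- by rewrite /F ltnn.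
Qed.

End PathCounts.

(** * Elementary bounds on the constant *)

Section Numerics.
Context {R : realFieldType}.
Implicit Types lam p q T : R.
Local Open Scope ring_scope.

(** The bound [7 / 20] is exactly the threshold in [third_above], where [3 * (6 * lam - 2)] must
    stay below [1 - 2 * lam]. *)
Lemma root_bounds lam : 0 < lam -> 26 * lam ^+ 2 + 3 * lam = 4 ->
  1 / 3 < lam < 7 / 20.
Proof.
rewrite expr2 => lam_gt0 lamE; rewrite !ltNge.
by apply/andP; split; apply/negP; rewrite -subr_ge0 => h;
   have := mulr_ge0 h (ltW lam_gt0); lra.
Qed.

Lemma complement_lt lam T p q : p + q = T -> p < lam * T \/ q < lam * T ->
  p <= (1 - lam) * T -> p < lam * T.
Proof. by move=> <- []; lra. Qed.

End Numerics.

(** * Normalised path counts and the jump forced by a gap *)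

Section Balance.
Context {d : Order.disp_t} {P : finPOrderType d} {R : realFieldType}.
Variable lam : R.
Hypotheses (lam_gt0 : (0 < lam)%R) (lamE : (26 * lam ^+ 2 + 3 * lam = 4)%R).
Implicit Types (A B : seq P) (i j k l : nat).
Local Open Scope ring_scope.

Let lam_bounds := root_bounds lam_gt0 lamE.

Definition gapped (S : {set P}) : Prop := {in S &, forall u v, u != v ->
  (num_lt S u v)%:R < lam * (num S)%:R \/ (num_lt S v u)%:R < lam * (num S)%:R}.

Definition npaths A B i j : R := (paths A B i j)%:R / (paths A B 0 0)%:R.

(** The probability that exactly [i] elements of [A] precede the [j]-th element of [B] (counted from
    0); [acc] is the corresponding distribution function. *)
Definition step A B j i : R := (paths_to A B j i)%:R * npaths A B i j.+1.

Definition acc A B j t : R := \sum_(i < t) step A B j i.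

Lemma paths00 A B : paths A B 0 0 = num [set x in A ++ B].
Proof. by rewrite /paths valid00 mul1n /rest !drop0. Qed.

Lemma paths00_gt0 A B : 0 < (paths A B 0 0)%:R :> R.
Proof. by rewrite paths00 ltr0n num_gt0. Qed.

Lemma npathsC A B i j : npaths A B i j = npaths B A j i.
Proof. by rewrite /npaths pathsC (pathsC A B). Qed.

Lemma npaths_ge0 A B i j : 0 <= npaths A B i j.
Proof. by rewrite divr_ge0 ?ler0n. Qed.

Lemma npaths00 A B : npaths A B 0 0 = 1.
Proof. by rewrite /npaths divff // gt_eqF // paths00_gt0. Qed.

Lemma npaths_invalid A B i j : ~~ valid A B i j -> npaths A B i j = 0.
Proof. by move=> v; rewrite /npaths paths_invalid // mul0r. Qed.

Lemma npaths_gt0_valid A B i j : 0 < npaths A B i j -> valid A B i j.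
Proof.
by apply: contraLR => /npaths_invalid->; rewrite ltxx.
Qed.

Lemma npaths_rec A B i j : two_chains A B -> valid A B i j ->
  ((i < size A) || (j < size B))%N ->
  npaths A B i j = npaths A B i.+1 j + npaths A B i j.+1.
Proof.
move=> AB vij ij; rewrite /npaths -mulrDl -natrD.
by rewrite (two_chains_paths_rec AB ij) vij mul1n.
Qed.

Lemma npaths_decrl A B i j : two_chains A B -> valid A B i j ->
  npaths A B i.+1 j <= npaths A B i j.
Proof.
move=> AB vij; rewrite ler_wpM2r ?invr_ge0 ?ler0n // ler_nat.
exact: paths_decrl.
Qed.

Lemma npaths_decrr A B i j : two_chains A B -> valid A B i j ->
  npaths A B i j.+1 <= npaths A B i j.
Proof.
by rewrite two_chainsC validC npathsC (npathsC A B); apply: npaths_decrl.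
Qed.

Lemma npaths_log_concave A B i j i' k :
  two_chains A B -> (i' <= i)%N -> (j <= k)%N ->
  npaths A B i j * npaths A B i' k.+1 <= npaths A B i j.+1 * npaths A B i' k.
Proof.
move=> AB ii jk; rewrite /npaths !mulf_div ler_wpM2r //.
  by rewrite invr_ge0 mulr_ge0 ?ler0n.
by rewrite -!natrM ler_nat paths_log_concave.
Qed.

Lemma step_ge0 A B j i : 0 <= step A B j i.
Proof. by rewrite mulr_ge0 ?ler0n ?npaths_ge0. Qed.

Lemma acc0 A B j : acc A B j 0 = 0.
Proof. by rewrite /acc big_ord0. Qed.

Lemma accS A B j t : acc A B j t.+1 = acc A B j t + step A B j t.
Proof. by rewrite /acc big_ord_recr. Qed.

Lemma acc_le A B j t t' : (t <= t')%N -> acc A B j t <= acc A B j t'.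
Proof.
move=> tt; rewrite -(subnKC tt); elim: (t' - t)%N => [|p IHp].
  by rewrite addn0.
by rewrite addnS accS (le_trans IHp) // lerDl step_ge0.
Qed.

Lemma acc_nat A B j t :
  acc A B j t = (\sum_(i < t) paths_to A B j i * paths A B i j.+1)%N%:R
    / (paths A B 0 0)%:R.
Proof.
rewrite natr_sum mulr_suml; apply: eq_bigr => i _.
by rewrite /step /npaths natrM mulrA.
Qed.

(* As [t] grows, [acc A B j t] goes from [0] to [1] through the probabilities *)
(* that the [j]-th element of [B] precedes a given element of [A].            *)
Lemma crossing A B j : two_chains A B -> gapped [set x in A ++ B] ->
  (j < size B)%N ->
  exists2 k, (k <= size A)%N & acc A B j k < lam /\ 1 - lam < acc A B j k.+1.
Proof.
move=> AB gap ltj; have lam1 : 0 < 1 - lam.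
  by have /andP[_ h] := lam_bounds; rewrite subr_gt0 (lt_trans h) //; lra.
have T0 := paths00_gt0 A B.
have total : acc A B j (size A).+1 = 1.
  by rewrite acc_nat -paths00_sum // divff // gt_eqF.
have ex : exists t, 1 - lam < acc A B j t.
  by exists (size A).+1; rewrite total ltrBlDr ltrDl.
(* At the least [t] with [acc] above [1 - lam], the preceding value is at most [1 - lam]. It is 0 or
   the probability of a comparison, so the gap pushes it below [lam]. *)
case: (ex_minnP ex) => -[|k] lek kmin.
  by move: lek; rewrite acc0 ltNge (ltW lam1).
have ltk : (k <= size A)%N.
  by have := kmin (size A).+1; rewrite total ltnS ltrBlDr ltrDl; apply.
exists k => //; split=> //; case: k lek kmin ltk => [|k] _ kmin ltk.
  by rewrite acc0.
have : acc A B j k.+1 <= 1 - lam.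
  by rewrite leNgt; apply/negP => /kmin; rewrite ltnn.
have /and3P[_ _ uAB] := AB; have x0 : P by case: (B) ltj.
have bS : nth x0 B j \in [set x in A ++ B].
  by rewrite inE mem_cat mem_nth ?orbT.
have aS : nth x0 A k \in [set x in A ++ B] by rewrite inE mem_cat mem_nth.
have ba : nth x0 B j != nth x0 A k by rewrite eq_sym nth_neq.
rewrite acc_nat -(num_lt_sum_paths x0) // ler_pdivrMr // ltr_pdivrMr //.
apply: complement_lt; last by rewrite paths00; apply: gap bS aS ba.
by rewrite -natrD paths00 num_ltC.
Qed.

End Balance.

Arguments npaths {d P} R A B i j.
Arguments step {d P} R A B j i.
Arguments acc {d P} R A B j t.

(** * The two numerical contradictions with log-concavity *)

Section NumericContradictions.
Context {R : realFieldType}.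
Variable lam : R.
Hypotheses (lam_gt0 : (0 < lam)%R) (lamE : (26 * lam ^+ 2 + 3 * lam = 4)%R).
Local Open Scope ring_scope.

(** There is room to spare: the left side of the last inequality is at least 0.208, the right side
    at most 0.1225. *)
Lemma jump1_absurd (q y : R) : 0 <= q -> q < lam -> 1 - lam < 2 * y ->
  (1 - q) * y <= q ^+ 2 -> False.
Proof.
have /andP[l1 l2] := root_bounds lam_gt0 lamE.
move=> q0 ql ly le1.
have q1 : q <= 7 / 20 by lra.
have y1 : 8 / 25 <= y by lra.
have h1 : q * q <= 7 / 20 * (7 / 20) by apply: ler_pM.
have h2 : 13 / 20 * (8 / 25) <= (1 - q) * y by apply: ler_pM; lra.
move: le1; rewrite expr2 => le1; lra.
Qed.

(* Once [q] is replaced by [lam] and [z] by its lower bound, the inequality   *)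
(* to refute is convex in [y]. At [y = (1 - lam) / 5] it is an equality, by   *)
(* the equation defining [lam], and at [y = lam / 2] it fails.                *)
Lemma jump2_absurd (q y z : R) : 1 - 2 * lam < q -> q < lam ->
    2 * y < lam -> 1 - lam < 2 * y + 3 * z -> z <= y ->
  (1 - 2 * q) * z <= (q - y) ^+ 2 -> False.
Proof.
have /andP[l1 l2] := root_bounds lam_gt0 lamE.
move=> q0 ql yl yz zy le1.
have h1 : (q - y) * (q - y) <= (lam - y) * (lam - y) by apply: ler_pM; lra.
have h2 : 0 < (lam - q) * z by apply: mulr_gt0; lra.
have h3 : 0 < (1 - 2 * lam) * (2 * y + 3 * z - (1 - lam)).
  by apply: mulr_gt0; lra.
have h4 : 0 <= (y - (1 - lam) / 5) * (lam / 2 - y) by apply: mulr_ge0; lra.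
(* The second factor is three times the distance from [lam / 2] to the other root of the quadratic
   in [y], whose first root is [(1 - lam) / 5]. *)
have h5 : 0 <= (y - (1 - lam) / 5) * (91 / 10 * lam - 26 / 10).
  by apply: mulr_ge0; lra.
move: le1 lamE; rewrite !expr2 => le1 E; lra.
Qed.

End NumericContradictions.

(** * Small lower sets when both chains start at minimal elements *)

Section Bottom.
Context {d : Order.disp_t} {P : finPOrderType d} {R : realFieldType}.
Variable lam : R.
Hypotheses (lam_gt0 : (0 < lam)%R) (lamE : (26 * lam ^+ 2 + 3 * lam = 4)%R).
Implicit Types (A B : seq P) (i j k l : nat).
Local Open Scope ring_scope.

Let lam_bounds := root_bounds lam_gt0 lamE.

Lemma valid_join A B i j i' j' : (i' <= i)%N -> (j <= j')%N ->
  valid A B i j -> valid A B i' j' -> valid A B i j'.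
Proof.
move=> ii jj /and4P[lei _ nb _] /and4P[_ lej _ nb'].
by rewrite /valid lei lej (noback_mono _ jj nb) ?(noback_mono _ ii nb').
Qed.

Lemma valid_rowS A B i : valid A B i.+1 0 -> valid A B i 0.
Proof.
case/and4P=> lei _ nb _.
by rewrite /valid (ltnW lei) (noback_mono _ _ nb) // noback0.
Qed.

Lemma valid_midl A B i j : valid A B 0 j -> valid A B i.+1 j ->
  valid A B i j.
Proof.
move=> /and4P[_ _ _ nb0] /and4P[lei lej nb _].
by rewrite /valid (ltnW lei) lej (noback_mono _ _ nb) ?(noback_mono _ _ nb0).
Qed.

Lemma paths_to0 A B i : paths_to A B 0 i = valid A B i 0.
Proof.
elim: i => [|i IHi] /=; first by rewrite valid00.
rewrite -[sweep _ _ i]/(paths_to A B 0 i) IHi add0n.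
by case: (boolP (valid A B i.+1 0)) => // /valid_rowS ->.
Qed.

Lemma paths_toS0 A B j :
  paths_to A B j.+1 0 = (valid A B 0 j.+1 * paths_to A B j 0)%N.
Proof. by rewrite /= addn0. Qed.

Lemma paths_toSS A B j i : paths_to A B j.+1 i.+1 =
  (valid A B i.+1 j.+1 * (paths_to A B j i.+1 + paths_to A B j.+1 i))%N.
Proof. by []. Qed.

(** Three paths lead to [(2, 1)], and each extends along row 1. *)
Lemma paths_to1_ge3 A B k : valid A B 1 0 -> valid A B 2 0 -> valid A B 0 1 ->
  valid A B k.+2 1 -> (3 <= paths_to A B 1 k.+2)%N.
Proof.
move=> v10 v20 v01; have v11 := valid_join (leq0n 1) (leq0n 1) v10 v01.
elim: k => [|k IHk] v; rewrite paths_toSS v mul1n.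
  by rewrite paths_to0 v20 paths_toSS v11 paths_to0 v10 paths_toS0 v01
             paths_to0 valid00.
by rewrite (leq_trans (IHk _)) ?leq_addl //; apply: valid_midl v.
Qed.

Section Jumps.
Variables A B : seq P.
Hypotheses (AB : two_chains A B) (gap : gapped lam [set x in A ++ B]).
Hypotheses (v10 : valid A B 1 0) (v01 : valid A B 0 1).
Hypothesis q1_lt : npaths R A B 0 1 < lam.

Let sizeA_gt0 : (0 < size A)%N. Proof. by case/and4P: v10. Qed.
Let sizeB_gt0 : (0 < size B)%N. Proof. by case/and4P: v01. Qed.
Let v11 : valid A B 1 1 := valid_join (leq0n 1) (leq0n 1) v10 v01.

Lemma step0 i : step R A B 0 i = (valid A B i 0)%:R * npaths R A B i 1.
Proof. by rewrite /step paths_to0. Qed.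

Lemma step0_decr i : step R A B 0 i.+1 <= step R A B 0 i.
Proof.
rewrite !step0; case: (boolP (valid A B i.+1 0)) => [v|_]; last first.
  by rewrite mul0r mulr_ge0 ?ler0n ?npaths_ge0.
have v' := valid_rowS v; rewrite v' !mul1r npaths_decrl //.
exact: valid_join (leq0n i) (leq0n 1) v' v01.
Qed.

(** The steps decrease. A jump after the second step would follow two steps larger than
    [1 - 2 * lam], whose sum already exceeds [lam]; a jump at the first step is excluded by
    [q1_lt]. *)
Lemma first_jump :
  1 - 2 * lam < npaths R A B 1 1 /\
  1 - lam < npaths R A B 0 1 + npaths R A B 1 1.
Proof.
have /andP[l1 l2] := lam_bounds.
have s0 : step R A B 0 0 = npaths R A B 0 1 by rewrite step0 valid00 mul1r.
have s1 : step R A B 0 1 = npaths R A B 1 1 by rewrite step0 v10 mul1r.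
have [[|[|k]] _ []] := crossing lam_gt0 lamE AB gap sizeB_gt0.
- by rewrite accS acc0 s0; move: q1_lt; lra.
- by rewrite !accS acc0 s0 s1; move: q1_lt; lra.
move=> lt_lam; rewrite accS => gt_lam; exfalso.
have le2 : step R A B 0 0 + step R A B 0 1 <= acc R A B 0 k.+2.
  rewrite (le_trans _ (acc_le _ _ _ (isT : 2 <= k.+2)%N)) //.
  by rewrite !accS acc0 add0r.
have le1 : step R A B 0 k.+2 <= step R A B 0 1.
  by elim: (k.+1) => // p IHp; apply: le_trans (step0_decr _) IHp.
have le0 := step0_decr 0.
move: lt_lam gt_lam le2 le1 le0; lra.
Qed.

Let q1 := npaths R A B 0 1.
Let q2 := npaths R A B 1 1.
Let q3 := npaths R A B 2 1.
Let r := npaths R A B 2 0.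
Let x := npaths R A B 0 2.
Let y := npaths R A B 1 2.
Let z := npaths R A B 2 2.

Lemma total_mass : q1 + q2 + r = 1.
Proof.
rewrite -[RHS](npaths00 A B) npaths_rec ?valid00 ?sizeA_gt0 //.
rewrite [npaths R A B 1 0]npaths_rec ?sizeB_gt0 ?orbT // -/q1 -/q2 -/r; lra.
Qed.

(** Otherwise [r = 0], while [r = 1 - q1 - q2] and [q2 <= q1 < lam]. *)
Lemma v20 : valid A B 2 0.
Proof.
apply: (@npaths_gt0_valid _ _ R); have [h1 h2] := first_jump.
have /andP[l1 l2] := lam_bounds; have := total_mass.
have q21 : q2 <= q1 by apply: npaths_decrl.
move: q1_lt h1 h2 q21; rewrite -/q1 -/q2 -/r; lra.
Qed.

Let v21 : valid A B 2 1 := valid_join (leq0n 2) (leq0n 1) v20 v01.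
Let sizeA_gt1 : (1 < size A)%N. Proof. by case/and4P: v20. Qed.

Lemma q1E : q1 = q2 + x.
Proof. by rewrite /q1 npaths_rec ?sizeA_gt0. Qed.

Lemma q2E : q2 = q3 + y.
Proof. by rewrite /q2 npaths_rec ?sizeA_gt1. Qed.

Section Overlap.
Hypothesis v12 : valid A B 1 2.

Let sizeB_gt1 : (1 < size B)%N. Proof. by case/and4P: v12. Qed.

(** The coefficients 1, 2, 3 count the paths to [(0, 1)], [(1, 1)] and [(2, 1)]. *)
Lemma step1_012 : [/\ step R A B 1 0 = x, step R A B 1 1 = 2 * y
  & step R A B 1 2 = 3 * z].
Proof.
by split; rewrite /step ?paths_toSS ?paths_toS0 !paths_to0 ?valid00 v01
  ?v11 ?v10 ?v21 ?v20 //= mul1r.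
Qed.

Lemma npaths2_decr i : npaths R A B i.+2 2 <= npaths R A B i.+1 2.
Proof.
case: (boolP (valid A B i.+2 2)) => v; last first.
  by rewrite (npaths_invalid v) npaths_ge0.
apply: npaths_decrl => //; have /and4P[lei lej nb _] := v.
rewrite /valid (ltnW lei) lej (noback_mono _ _ nb) //=.
by case/and4P: v12 => _ _ _; apply: noback_mono.
Qed.

(** At most one new path, the one along row 0, joins at each column, and at least three are there
    already; the factor [npaths] does not increase. *)
Lemma step1_ratio k : 3 * step R A B 1 k.+3 <= 4 * step R A B 1 k.+2.
Proof.
have le_to : (3 * paths_to A B 1 k.+3 <= 4 * paths_to A B 1 k.+2)%N.
  rewrite paths_toSS; case: (boolP (valid A B k.+3 1)) => // v.
  have := paths_to1_ge3 v10 v20 v01 (valid_midl v01 v).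
  rewrite mul1n paths_to0; move: (paths_to A B 1 k.+2) => p.
  by case: valid; clear; lia.
rewrite /step [3 * _]mulrA [4 * _]mulrA.
apply: ler_pM; last exact: npaths2_decr.
- by rewrite mulr_ge0 ?ler0n.
- exact: npaths_ge0.
by move: le_to; rewrite -(ler_nat R) !natrM.
Qed.

(** Excludes a jump after the third step: that would give [5 * (1 - 2 * lam) < 4 * lam], hence
    [lam > 5 / 14]. *)
Lemma late_step1 k : 5 * step R A B 1 k.+3 <= 4 * acc R A B 1 k.+3.
Proof.
have [s0 s1 s2] := step1_012.
elim: k => [|k IHk]; last first.
  have := step1_ratio k.+1; rewrite accS.
  have h : 0 <= step R A B 1 k.+3 := step_ge0 _ _ _ _.
  move: IHk h; lra.
have := step1_ratio 0; rewrite !accS acc0 s0 s1 s2.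
have zy : z <= y := npaths2_decr 0.
have x0 : 0 <= x := npaths_ge0 _ _ _ _.
move: zy x0; lra.
Qed.

Lemma overlap_absurd : False.
Proof.
have /andP[l1 l2] := lam_bounds.
have [q2_gt q12] := first_jump; rewrite -/q1 -/q2 in q2_gt q12.
have tot := total_mass; have e1 := q1E; have e2 := q2E.
have [s0 s1 s2] := step1_012.
have zy : z <= y := npaths2_decr 0.
have x_ge0 : 0 <= x := npaths_ge0 _ _ _ _.
have y_ge0 : 0 <= y := npaths_ge0 _ _ _ _.
have q1lt : q1 < lam by [].
(* If [x > 0], then [(0, 2)] is a lower set and [z <= y <= x], so the sum is at most [6 * x]; but
   [x = q1 - q2 < 3 * lam - 1] is too small for that. *)
have x0 : 1 - lam < x + 2 * y + 3 * z -> x = 0.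
  move=> big; apply: contraTeq isT => x_neq0.
  have : valid A B 0 2.
    by apply: (@npaths_gt0_valid _ _ R); rewrite lt_def x_neq0 x_ge0.
  move=> v02; have yx : y <= x by apply: npaths_decrl.
  suff : x < x by rewrite ltxx.
  move: big zy yx q2_gt q1lt e1 l1 l2; lra.
have [[|[|[|k]]] _ []] := crossing lam_gt0 lamE AB gap sizeB_gt1.
- rewrite accS acc0 s0 => _ big.
  move: big q2_gt q1lt e1 l1 l2; lra.
- rewrite !accS acc0 s0 s1 => small big.
  have z_ge0 : 0 <= z := npaths_ge0 _ _ _ _.
  have xE : x = 0 by apply: x0; move: big z_ge0; lra.
  have q12E : q1 = q2 by rewrite e1 xE addr0.
  apply: (@jump1_absurd _ _ lam_gt0 lamE q2 y); rewrite -?q12E //.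
  + exact: npaths_ge0.
  + by move: big; rewrite xE; lra.
  have : npaths R A B 1 0 * y <= q2 * q2.
    exact: npaths_log_concave AB (leqnn 1) (leq0n 1).
  suff -> : npaths R A B 1 0 = 1 - q1 by rewrite expr2 q12E.
  rewrite -(npaths00 A B) (npaths_rec AB (valid00 A B)) ?sizeA_gt0 //.
  by rewrite -/q1 addrK.
- rewrite !accS acc0 s0 s1 s2 => small big.
  have xE : x = 0 by apply: x0; move: big; lra.
  have q12E : q1 = q2 by rewrite e1 xE addr0.
  apply: (@jump2_absurd _ _ lam_gt0 lamE q2 y z) => //; rewrite -?q12E //.
  + by move: small; rewrite xE; lra.
  + by move: big; rewrite xE; lra.
  have le : r * z <= q3 * q3.
    exact: npaths_log_concave AB (leqnn 2) (leq0n 1).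
  have -> : 1 - 2 * q1 = r by move: tot; rewrite -q12E; lra.
  have -> : q1 - y = q3 by move: e2; rewrite -q12E; lra.
  by rewrite expr2.
move=> small; rewrite accS; have := late_step1 k; move: small l1 l2; lra.
Qed.

End Overlap.

Lemma no_overlap : ~~ valid A B 1 2.
Proof. by apply/negP=> /overlap_absurd. Qed.

Lemma npaths3_decr i : valid A B 3 0 -> npaths R A B 3 i <= npaths R A B 3 0.
Proof.
move=> v30; elim: i => // i IHi.
case: (boolP (valid A B 3 i.+1)) => v; last first.
  by rewrite (npaths_invalid v) npaths_ge0.
rewrite (le_trans _ IHi) // npaths_decrr //.
by rewrite validC; apply: valid_midl; rewrite validC.
Qed.

(** By [no_overlap], a second element of [B] can only come after two elements of [A]; all that
    varies is the position of the first element of [B] among these two. *)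
Lemma paths_to_third i : (paths_to B A 2 i <= 3)%N.
Proof.
have le1 k : (paths_to B A 0 k <= 1)%N by rewrite paths_to0; case: valid.
have leS j k : (paths_to B A j.+1 k.+1 <=
    paths_to B A j k.+1 + paths_to B A j.+1 k)%N.
  by rewrite paths_toSS; case: valid; rewrite ?mul1n.
have le0 j : (paths_to B A j 0 <= 1)%N.
  elim: j => [|j IHj]; first exact: le1.
  by rewrite paths_toS0; case: valid; rewrite ?mul1n.
have to1 k : paths_to B A 1 k.+2 = 0%N.
  rewrite paths_toSS (negPf (_ : ~~ valid B A k.+2 1)) //.
  apply: contra no_overlap; rewrite validC => v.
  elim: k v => // k IHk v; apply: IHk.
  by rewrite validC; apply: valid_midl; rewrite validC.
case: i => [|i]; first exact: leq_trans (le0 2) _.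
elim: i => [|i IHi].
  apply: leq_trans (leS 1 0)%N _; rewrite -[3%N]/(2 + 1)%N leq_add ?le0 //.
  exact: leq_trans (leS 0 0)%N (leq_add (le1 1%N) (le0 1%N)).
by apply: leq_trans (leS 1 i.+1)%N _; rewrite to1 add0n.
Qed.

(** Now [x = y = 0], so [q1 = q2 = q3] and [npaths R A B 3 0 = 1 - 3 * q2 < 6 * lam - 2]. Every step
    for the third element of [A] is at most three times this, less than the jump that [crossing]
    demands. *)
Lemma third_above : ~~ valid A B 3 0.
Proof.
apply/negP=> v30; have sizeA_gt2 : (2 < size A)%N by case/and4P: v30.
have BA : two_chains B A by rewrite two_chainsC.
have gap' : gapped lam [set x in B ++ A].
  by move: gap; congr (gapped _ _); apply/setP=> u; rewrite !inE !mem_cat orbC.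
have [k _ []] := crossing lam_gt0 lamE BA gap' sizeA_gt2; rewrite accS.
have : step R B A 2 k <= 3 * npaths R A B 3 0.
  rewrite /step npathsC ler_pM ?ler0n ?npaths_ge0 //.
    by rewrite (ler_nat _ _ 3) paths_to_third.
  exact: npaths3_decr.
have y0 : y = 0 by apply: npaths_invalid no_overlap.
have x0 : x = 0.
  apply: npaths_invalid; apply: contra no_overlap => v02.
  exact: valid_join (leq0n 1) (leq0n 2) v10 v02.
have [q2_gt _] := first_jump; have /andP[l1 l2] := lam_bounds.
have e1 := q1E; have e2 := q2E; have tot := total_mass.
have e3 : r = npaths R A B 3 0 + q3.
  by rewrite /r (npaths_rec AB v20) ?sizeA_gt2.
move: y0 x0 q2_gt l1 l2 e1 e2 e3 tot; rewrite -/q2; lra.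
Qed.

End Jumps.
End Bottom.

(** * Splitting off bottom blocks *)

Section Assembly.
Context {d : Order.disp_t} {P : finPOrderType d} {R : realFieldType}.
Variable lam : R.
Hypotheses (lam_gt0 : (0 < lam)%R) (lamE : (26 * lam ^+ 2 + 3 * lam = 4)%R).
Implicit Types (A B : seq P) (S D : {set P}).

Lemma gapped_sum D S : all_below D S -> gapped lam (D :|: S) -> gapped lam S.
Proof.
move=> DS gap u v uS vS uv; have nD : (0 < (num D)%:R :> R)%R.
  by rewrite ltr0n num_gt0.
have := gap u v; rewrite !inE uS vS !orbT => /(_ isT isT uv).
rewrite !num_lt_sum // 1?eq_sym // num_sum // !natrM mulrCA.
by rewrite !(ltr_pM2l nD).
Qed.

(** Either [A] is empty, or some element of [B], and with it the first one, lies below the head of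
    [A]; the head of [B] is then below all the rest. *)
Lemma bottom_single A B : two_chains A B -> A ++ B != [::] ->
  ~~ valid A B 1 0 ->
  exists2 b, b \in A ++ B & {in A ++ B, forall x, x != b -> (b < x)%O}.
Proof.
case/and3P=> sA sB _; case: A sA => [|a A] sA.
  case: B sB => [|b B] //= /(order_path_min lt_trans)/allP sB _ _.
  exists b; first exact: mem_head.
  by move=> x; rewrite inE => /predU1P[->|/sB //]; rewrite eqxx.
move=> _; rewrite /valid /= noback0 andbT /noback /= take0 drop0 /= andbT.
case/allPn=> y yB; rewrite negbK => ya.
have {}sA := order_path_min lt_trans sA; move/allP: sA => sA.
case: B sB yB => [|b B] //= /(order_path_min lt_trans)/allP sB yB.
have ba : (b < a)%O.
  by move: yB; rewrite inE => /predU1P[<- //|/sB/lt_trans]; apply.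
exists b; first by rewrite -cat_cons mem_cat mem_head orbT.
move=> x; rewrite inE mem_cat => /predU1P[-> //|/orP[/sA|]].
  by move=> ax _; apply: lt_trans ba ax.
by rewrite inE => /predU1P[->|/sB //]; rewrite eqxx.
Qed.

(** The block is [{a1, a2, b1}]. The valid pairs make [b1] incomparable to [a1] and [a2]; the
    invalid ones put [b1] below any third element of [A] and [a2] below any second element of
    [B]. *)
Lemma bottom_E A B : two_chains A B ->
    valid A B 0 1 -> valid A B 2 0 -> ~~ valid A B 3 0 -> ~~ valid A B 1 2 ->
  exists D, [/\ E_triple D, {subset D <= A ++ B} &
    {in D & A ++ B, forall x y, y \notin D -> (x < y)%O}].
Proof.
case/and3P=> sA sB uAB.
case: B sB uAB => [|b1 B] sB uAB; first by case/and4P.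
case: A sA uAB => [|a1 [|a2 A]] sA uAB; [by move=> _ /and4P[]..|].
move: sA sB => /= /andP[a12 pA] pB.
have /allP sA := order_path_min lt_trans pA.
have /allP sB := order_path_min lt_trans pB.
rewrite /valid /noback /= ?take0 ?drop0 /= ?andbT => v01 v20 v30 v12.
have /and3P[ab1 ab2 abA] := v01.
have /and3P[/andP[ba1 Ba1] ba2 Ba2] := v20.
have bA : {in A, forall x, (b1 < x)%O}.
  move: v30; case: (A) pA => // a3 A' /= /andP[_ pA].
  rewrite ba1 ba2 Ba1 Ba2 take0 /= andbT => nb3 x.
  have b3 : (b1 < a3)%O.
    move: nb3; rewrite negb_and negbK => /orP[//|/allPn[y yB]].
    by rewrite negbK; apply: lt_trans; apply: sB.
  have /allP pA' := order_path_min lt_trans pA.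
  by rewrite inE => /predU1P[->//|/pA']; apply: lt_trans.
have aB : {in B, forall x, (a2 < x)%O}.
  move: v12 Ba1; case: (B) pB => // b2 B' /= /andP[_ pB] + /andP[_ Ba1].
  rewrite drop0 Ba1 ab2 abA take0 /= andbT => na2 x.
  have a2b2 : (a2 < b2)%O.
    move: na2; rewrite negb_and negbK => /orP[//|/allPn[y yA]].
    by rewrite negbK; apply: lt_trans; apply: sA.
  have /allP pB' := order_path_min lt_trans pB.
  by rewrite inE => /predU1P[->//|/pB']; apply: lt_trans.
have inc a : a \in [:: a1; a2] -> ~~ (b1 < a)%O -> ~~ (a < b1)%O -> (a >< b1)%O.
  move=> aA ba ab; have aneq : a != b1.
    move: uAB; rewrite -cat1s -[_ ++ _]/([:: a1; a2] ++ A ++ b1 :: B).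
    rewrite cat_uniq => /and3P[_ /hasPn out _].
    apply: contraTneq aA => ->; apply: out.
    by rewrite mem_cat mem_head orbT.
  by rewrite /Order.comparable !le_eqVlt [b1 == a]eq_sym (negPf aneq)
     (negPf ab) (negPf ba).
exists [set a1; a2; b1]; split.
- by exists a1, a2, b1; split; rewrite // inc // !inE eqxx ?orbT.
- move=> x; rewrite !inE mem_cat inE.
  by case/orP=> [/orP[]|] /eqP->; rewrite eqxx ?orbT.
move=> x y xD; rewrite -[_ :: _]/([:: a1; a2] ++ A ++ b1 :: B) => yAB yD.
have : (y \in A) || (y \in B).
  move: yAB yD; rewrite !mem_cat !inE.
  by case: (y == a1); case: (y == a2); case: (y == b1); case: (y \in A).
move: xD; rewrite !inE => /orP[/orP[]|] /eqP-> /orP[] yI.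
- exact: lt_trans a12 (sA y yI).
- exact: lt_trans a12 (aB y yI).
- exact: sA.
- exact: aB.
- exact: bA.
- exact: sB.
Qed.

Hypothesis no3 : forall x y z : P,
  (x >< y)%O -> (y >< z)%O -> (x >< z)%O -> False.

(** If both heads are minimal, the gap makes one of their two orders less likely than [lam];
    exchanging the chains if necessary, this is the hypothesis [q1_lt]. *)
Lemma gapped_bottom A B : two_chains A B -> A ++ B != [::] ->
    gapped lam [set x in A ++ B] ->
  exists2 D, block_set D & D \subset [set x in A ++ B] /\
    all_below D ([set x in A ++ B] :\: D).
Proof.
move=> AB AB0 gap.
have single s b : s =i A ++ B -> b \in s ->
    {in s, forall x, x != b -> (b < x)%O} ->
    exists2 D, block_set D & D \subset [set x in A ++ B] /\
      all_below D ([set x in A ++ B] :\: D).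
  move=> sE bs blt; exists [set b]; first exact: Block_set1.
  split; first by rewrite sub1set inE -sE.
  by move=> x y /set1P->; rewrite !inE -sE => /andP[yb ys]; apply: blt.
have BA : two_chains B A by rewrite two_chainsC.
have memBA : B ++ A =i A ++ B by move=> x; rewrite !mem_cat orbC.
have [v10|v10] := boolP (valid A B 1 0); last first.
  by have [b bs blt] := bottom_single AB AB0 v10; apply: single bs blt.
have [v01|v01] := boolP (valid A B 0 1); last first.
  have BA0 : B ++ A != [::].
    by rewrite -size_eq0 size_cat addnC -size_cat size_eq0.
  rewrite validC in v01; have [b bs blt] := bottom_single BA BA0 v01.
  exact: single memBA bs blt.
have triple A' B' : two_chains A' B' -> A' ++ B' =i A ++ B ->
    valid A' B' 1 0 -> valid A' B' 0 1 -> (npaths R A' B' 0 1 < lam)%R ->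
    exists2 D, block_set D & D \subset [set x in A ++ B] /\
      all_below D ([set x in A ++ B] :\: D).
  move=> AB' sE w10 w01 small.
  have gap' : gapped lam [set x in A' ++ B'].
    by move: gap; congr (gapped _ _); apply/setP=> x; rewrite !inE sE.
  have w20 := v20 lam_gt0 lamE AB' gap' w10 w01 small.
  have w30 := third_above lam_gt0 lamE AB' gap' w10 w01 small.
  have w12 := no_overlap lam_gt0 lamE AB' gap' w10 w01 small.
  have [D [ED sub low]] := bottom_E AB' w01 w20 w30 w12.
  exists D; first exact: Block_setE.
  split; first by apply/subsetP=> x /sub; rewrite sE inE.
  move=> x y xD; rewrite !inE => /andP[yD yS]; apply: low => //.
  by rewrite sE.
have ltA : 0 < size A by case/and4P: v10.
have ltB : 0 < size B by case/and4P: v01.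
have x0 : P by case: (A) ltA.
have /and3P[_ _ uAB] := AB; have ab := nth_neq x0 uAB ltA ltB.
have num01 A' B' : two_chains A' B' -> 0 < size A' -> 0 < size B' ->
    num_lt [set x in A' ++ B'] (nth x0 B' 0) (nth x0 A' 0) = paths A' B' 0 1.
  move=> AB' ltA' ltB'; rewrite num_lt_sum_paths // big_ord1 paths_to0.
  by rewrite valid00 mul1n.
have SC : [set x in B ++ A] = [set x in A ++ B].
  by apply/setP=> x; rewrite !inE memBA.
have := gap (nth x0 B 0) (nth x0 A 0).
rewrite !inE !mem_cat !mem_nth ?orbT // eq_sym => /(_ isT isT ab).
rewrite num01 // -{2}SC num01 // -!paths00.
rewrite -!ltr_pdivrMr ?paths00_gt0 // => -[] small.
  exact: triple AB _ v10 v01 small.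
apply: (triple B A) => //; rewrite 1?validC //.
by rewrite /npaths (pathsC B A 0 0).
Qed.

Lemma gapped_blocky S : S != set0 -> gapped lam S -> blocky S.
Proof.
have [n] := ubnP #|S|; elim: n S => // n IHn S leSn S0 gap.
have [A [B [sA sB uAB SE]]] := two_sorted_cover no3 S; rewrite SE in S0 gap *.
have AB : two_chains A B by apply/and3P.
have AB0 : A ++ B != [::].
  by apply: contraNneq S0 => ->; apply/eqP/setP=> x; rewrite !inE.
have [D bD [DS low]] := gapped_bottom AB AB0 gap; rewrite -SE in DS low gap *.
have DE : D :|: (S :\: D) = S by rewrite -{1}(setIidPr DS) setID.
have [SD0|SD0] := eqVneq (S :\: D) set0.
  by rewrite -DE SD0 setU0; apply: Blocky_one.
rewrite -DE; apply: Blocky_add => //; apply: IHn => //; last first.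
  by apply: gapped_sum low _; rewrite DE.
have D0 : 0 < #|D|.
  by apply/card_gt0P; case: bD => [x|_ [x [y [z [-> _ _ _]]]]]; exists x;
     rewrite !inE eqxx.
rewrite cardsD (setIidPr DS) -ltnS (leq_trans _ leSn) // ltnS ltn_subrL D0.
by rewrite (leq_trans D0) ?subset_leq_card.
Qed.

End Assembly.

(** * From the balance constant to the gap *)

Lemma width2_no3 {d : Order.disp_t} (P : finPOrderType d) : width P <= 2 ->
  forall x y z : P, (x >< y)%O -> (y >< z)%O -> (x >< z)%O -> False.
Proof.
move=> w2 x y z xy yz xz.
have neq (a b : P) : (a >< b)%O -> a != b.
  by apply: contraNneq => ->; rewrite comparablexx.
have sym (a b : P) : (a >< b)%O = (b >< a)%O by rewrite comparable_sym.
have anti : antichain [set x; y; z].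
  apply/forall_inP=> a; rewrite !inE => aS; apply/forall_inP=> b.
  rewrite !inE => bS; apply/implyP; move: aS bS.
  by do 2!case/orP=> [/orP[]|] /eqP->; rewrite ?eqxx // sym.
have : #|[set x; y; z]| <= width P by apply: leq_bigmax_cond.
rewrite leqNgt (leq_ltn_trans w2) // setUC cardsU1 cards2 !inE.
by rewrite ![z == _]eq_sym negb_or !neq.
Qed.

Local Open Scope ring_scope.

Lemma prec_probE {d : Order.disp_t} (P : finPOrderType d) (R : rcfType)
  (u v : P) : u != v ->
  prec_prob R u v = (num_lt setT u v)%:R / (num [set: P])%:R.
Proof.
move=> uv; rewrite /prec_prob /num_lt /num exts_setT uv.
by congr (_%:R / _); apply: eq_card => L; rewrite !inE.
Qed.

Lemma balance_constant_ge {d : Order.disp_t} (P : finPOrderType d)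
    (R : rcfType) (lam : R) :
  0 < lam -> 26 * lam ^+ 2 + 3 * lam = 4 -> width P = 2%N ->
  ~ sum_of_1_and_E P -> lam <= balance_constant P R.
Proof.
move=> lam_gt0 lamE width_P not_sum_P; rewrite leNgt; apply/negP=> small.
apply/not_sum_P/blocky_sum_of_1_and_E.
have num_gt0R : 0 < (num [set: P])%:R :> R by rewrite ltr0n num_gt0.
have gap : gapped lam [set: P].
  move=> u v _ _ uv; have vu : v != u by rewrite eq_sym.
  rewrite -!ltr_pdivrMr // -(prec_probE R uv) -(prec_probE R vu).
  apply/orP; rewrite -gt_min; apply: le_lt_trans small.
  exact: (le_bigmax _ (fun p : P * P =>
    Num.min (prec_prob R p.1 p.2) (prec_prob R p.2 p.1)) (u, v)).
apply: (gapped_blocky lam_gt0 lamE _ _ gap).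
  by apply: width2_no3; rewrite width_P.
apply: contraTneq isT => T0; move: width_P; rewrite /width big1 // => A _.
by apply/eqP; rewrite cards_eq0 -subset0 -T0 subsetT.
Qed.

Theorem theorem1p4 (R : rcfType) (d : Order.disp_t) (P : finPOrderType d)
    (width_P : width P = 2%N) (not_sum_P : ~ sum_of_1_and_E P) :
  (- 3 + 5 * Num.sqrt 17) / 52 <= balance_constant P R.
Proof.
(* The constant is the positive root of [26 * lam ^+ 2 + 3 * lam = 4]; its discriminant is 425 = 25
   * 17. *)
apply: balance_constant_ge => //.
  have : 1 < Num.sqrt 17 :> R by rewrite -[X in X < _]sqrtr1 ltr_sqrt // ltr1n.
  by lra.
have : Num.sqrt 17 * Num.sqrt 17 = 17 :> R by rewrite -expr2 sqr_sqrtr.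
by rewrite expr2; lra.
Qed.
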